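(* Fix a binary floating-point format with significand precision $p\ge2$, rounding to nearest with ties to even, unit roundoff $u=2^{-p}$. Define $s=\lceil(p+2)/2\rceil$, $H=2^s$, $h=H^{-1}$, $\epsilon_A=h^2u/4$, and consider $A=\operatorname{diag}(\epsilon_A,1)$, $b=(1,H)^T$, $x_0=0$. Assume that every nonzero exact intermediate result in the four CG iterations and the first two Lanczos steps described in the context is normal and finite. Then the stored Lanczos vectors $v_1=(h,1)^T$ and $v_2=(-1,0)^T$ satisfy $$v_1^Tv_2=-h,\qquad \beta_2^{\rm lan}v_1^Tv_2=-h^2\in\{-u/4,-u/8\}.$$ The computed second diagonal coefficient is $$\alpha_2^{\rm lan}=\operatorname{fl}\bigl(v_2^TAv_2-\beta_2^{\rm lan}v_2^Tv_1\bigr)=\operatorname{fl}(\epsilon_A+h^2)=h^2 .$$ The exact Galerkin matrix of this stored basis, with $V_2=[v_1,v_2]$, is $$V_2^TAV_2=\begin{bmatrix} 1+\epsilon_Ah^2 & -\epsilon_Ah \\ -\epsilon_Ah & \epsilon_A \end{bmatrix}.$$ It is positive definite with determinant $\epsilon_A$. The local orthogonality term $-\beta_2^{\rm lan}v_2^Tv_1=h^2$ dominates $\epsilon_A=h^2u/4$ in the formation of the singular stored matrix $$T_2^{\rm lan}=\begin{bmatrix} 1 & h \\ h & h^2 \end{bmatrix}.$$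
   Context: $p$ counts the bits of the binary significand including the leading bit. $\operatorname{fl}$ denotes rounding to nearest, ties to even; every scalar assignment and vector component is stored before the next operation, products in vector updates are rounded before the addition or subtraction, and matrix-vector products and inner products are accumulated left to right. Exact zeros are allowed. Lanczos recurrence: $r_0=\operatorname{fl}(b-Ax_0)$, $v_0=0$, $\rho_0=\operatorname{fl}(\langle r_0,r_0\rangle)$, $\beta_1^{\rm lan}=\operatorname{fl}(\sqrt{\rho_0})$, $v_1=\operatorname{fl}(r_0/\beta_1^{\rm lan})$, and for $j=1,2,\dots$ $$q_j=\operatorname{fl}(Av_j),\quad w_j=\operatorname{fl}(q_j-\beta_j^{\rm lan}v_{j-1}),\quad \alpha_j^{\rm lan}=\operatorname{fl}(\langle v_j,w_j\rangle),\quad z_j=\operatorname{fl}(w_j-\alpha_j^{\rm lan}v_j),$$ $$\rho_j=\operatorname{fl}(\langle z_j,z_j\rangle),\quad \beta_{j+1}^{\rm lan}=\operatorname{fl}(\sqrt{\rho_j}),\quad v_{j+1}=\operatorname{fl}(z_j/\beta_{j+1}^{\rm lan}).$$ $T_2^{\rm lan}$ is the symmetric matrix with diagonal $\alpha_1^{\rm lan},\alpha_2^{\rm lan}$ and off-diagonal $\beta_2^{\rm lan}$. CG iterations (used only in the normality hypothesis): $r_0=p_0=b$, and for $j=0,1,2,3$: $q_j=\operatorname{fl}(Ap_j)$, $a_j=\operatorname{fl}(\operatorname{fl}(\langle r_j,r_j\rangle)/\operatorname{fl}(\langle q_j,p_j\rangle))$, $x_{j+1}=\operatorname{fl}(x_j+a_jp_j)$,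 $r_{j+1}=\operatorname{fl}(r_j-a_jq_j)$, $b_{j+1}=\operatorname{fl}(\operatorname{fl}(\langle r_{j+1},r_{j+1}\rangle)/\operatorname{fl}(\langle r_j,r_j\rangle))$, $p_{j+1}=\operatorname{fl}(r_{j+1}+b_{j+1}p_j)$. *)

(* Defs.v *)
From mathcomp Require Import all_boot all_order all_algebra.
From mathcomp Require Import all_classical all_reals all_analysis.

Set Implicit Arguments.
Unset Strict Implicit.
Unset Printing Implicit Defensive.

Import Order.TTheory GRing.Theory Num.Theory.
Local Open Scope ring_scope.

Section Rounding.
Variable R : realType.
Implicit Types x y : R.

Definition rne_int (x : R) : int :=
  let f := Num.floor x in
  let d := x - f%:~R in
  if d < 2^-1 then f
  else if 2^-1 < d then f + 1
  else if odd `|f|%N then f + 1 else f.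

(* The floating-point numbers are m * 2 ^ (e - p + 1) with m an integer,
   `|m| < 2 ^ p and emin <= e <= emax.  In [round_exp], ln 0 = 0 only affects
   the irrelevant exponent attached to 0. *)
Definition round_exp (emin : int) (y : R) : int :=
  Num.max emin (Num.floor (ln `|y| / ln 2)).

(* Nearest, ties to even, with gradual underflow below 2 ^ emin.  There is no
   upper bound on the exponent: overflow is the failure of [finite_result]. *)
Definition fl (p : nat) (emin : int) (y : R) : R :=
  let ulp := 2 ^ (round_exp emin y - p%:Z + 1) in
  (rne_int (y / ulp))%:~R * ulp.

Definition max_finite (p : nat) (emax : int) : R :=
  (2 - 2 ^ (1 - p%:Z)) * 2 ^ emax.

Definition normal_result (emin : int) (y : R) : Prop := 2 ^ emin <= `|y|.

Definition finite_result (p : nat) (emin emax : int) (y : R) : Prop :=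
  `|fl p emin y| <= max_finite p emax.

End Rounding.

(* A floating-point computation returns its stored value together with the
   list of the exact (unrounded) results of all operations it performed. *)
Definition traced (R T : Type) : Type := (T * seq R)%type.

Definition ret (R T : Type) (x : T) : traced R T := (x, [::]).

Definition bind (R T U : Type) (m : traced R T) (k : T -> traced R U) :
    traced R U :=
  let r := k m.1 in (r.1, m.2 ++ r.2).

Notation "x <-- m ;; k" := (bind m (fun x => k))
  (at level 100, m at next level, k at level 200, right associativity).

Definition value (R T : Type) (m : traced R T) : T := m.1.
Definition exact_results (R T : Type) (m : traced R T) : seq R := m.2.

Section Arithmetic.
Variables (R : realType) (p : nat) (emin : int).

Definition store (y : R) : traced R R := (fl p emin y, [:: y]).

Definition fadd (x y : R) := store (x + y).
Definition fsub (x y : R) := store (x - y).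
Definition fmul (x y : R) := store (x * y).
Definition fdiv (x y : R) := store (x / y).
Definition fsqrt (x : R) := store (Num.sqrt x).

Fixpoint fsumprod_from (a : R) (s : seq (R * R)) : traced R R :=
  if s is xy :: s' then
    c <-- fmul xy.1 xy.2 ;;
    a' <-- fadd a c ;;
    fsumprod_from a' s'
  else ret R a.

Definition fsumprod (s : seq (R * R)) : traced R R :=
  if s is xy :: s' then c <-- fmul xy.1 xy.2 ;; fsumprod_from c s'
  else ret R 0.

Variable n : nat.
Implicit Types (x y : 'cV[R]_n) (A : 'M[R]_n).

Definition fvec (F : 'I_n -> traced R R) : traced R 'cV[R]_n :=
  (\col_i value (F i), flatten [seq exact_results (F i) | i <- enum 'I_n]).

Definition fdot x y : traced R R :=
  fsumprod [seq (x i 0, y i 0) | i <- enum 'I_n].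

Definition fmulmx A x : traced R 'cV[R]_n :=
  fvec (fun i => fsumprod [seq (A i j, x j 0) | j <- enum 'I_n]).

Definition fvsub x y : traced R 'cV[R]_n :=
  fvec (fun i => fsub (x i 0) (y i 0)).

Definition fvdiv x (c : R) : traced R 'cV[R]_n :=
  fvec (fun i => fdiv (x i 0) c).

Definition fvadd_scaled x (c : R) y : traced R 'cV[R]_n :=
  fvec (fun i => t <-- fmul c (y i 0) ;; fadd (x i 0) t).

Definition fvsub_scaled x (c : R) y : traced R 'cV[R]_n :=
  fvec (fun i => t <-- fmul c (y i 0) ;; fsub (x i 0) t).

(* After j steps: v_j, v_{j+1}, alpha_j and beta_{j+1}; the alpha field of the
   initial state is a placeholder. *)
Record lanczos_state := LanczosState {
  lst_vprev : 'cV[R]_n;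
  lst_v : 'cV[R]_n;
  lst_alpha : R;
  lst_beta : R }.

Definition lanczos_init A (b x0 : 'cV[R]_n) : traced R lanczos_state :=
  q <-- fmulmx A x0 ;;
  r <-- fvsub b q ;;
  rho <-- fdot r r ;;
  beta <-- fsqrt rho ;;
  v <-- fvdiv r beta ;;
  ret R (LanczosState 0 v 0 beta).

Definition lanczos_step A (st : lanczos_state) : traced R lanczos_state :=
  q <-- fmulmx A (lst_v st) ;;
  w <-- fvsub_scaled q (lst_beta st) (lst_vprev st) ;;
  alpha <-- fdot (lst_v st) w ;;
  z <-- fvsub_scaled w alpha (lst_v st) ;;
  rho <-- fdot z z ;;
  beta <-- fsqrt rho ;;
  v <-- fvdiv z beta ;;
  ret R (LanczosState (lst_v st) v alpha beta).

Fixpoint lanczos A (b x0 : 'cV[R]_n) (j : nat) : traced R lanczos_state :=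
  if j is j'.+1 then st <-- lanczos A b x0 j' ;; lanczos_step A st
  else lanczos_init A b x0.

(* Meaningful for j >= 1. *)
Definition lanczos_v A (b x0 : 'cV[R]_n) (j : nat) : 'cV[R]_n :=
  lst_v (value (lanczos A b x0 j.-1)).
Definition lanczos_alpha A (b x0 : 'cV[R]_n) (j : nat) : R :=
  lst_alpha (value (lanczos A b x0 j)).
Definition lanczos_beta A (b x0 : 'cV[R]_n) (j : nat) : R :=
  lst_beta (value (lanczos A b x0 j.-1)).

Definition lanczos_T2 A (b x0 : 'cV[R]_n) : 'M[R]_2 :=
  \matrix_(i, j) if i == j then lanczos_alpha A b x0 i.+1
                 else lanczos_beta A b x0 2.

Record cg_state := CGState {
  cg_x : 'cV[R]_n;
  cg_r : 'cV[R]_n;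
  cg_p : 'cV[R]_n }.

Definition cg_step A (st : cg_state) : traced R cg_state :=
  q <-- fmulmx A (cg_p st) ;;
  rr <-- fdot (cg_r st) (cg_r st) ;;
  qp <-- fdot q (cg_p st) ;;
  a <-- fdiv rr qp ;;
  x <-- fvadd_scaled (cg_x st) a (cg_p st) ;;
  r <-- fvsub_scaled (cg_r st) a q ;;
  rr' <-- fdot r r ;;
  b <-- fdiv rr' rr ;;
  d <-- fvadd_scaled r b (cg_p st) ;;
  ret R (CGState x r d).

Fixpoint cg A (b : 'cV[R]_n) (j : nat) : traced R cg_state :=
  if j is j'.+1 then st <-- cg A b j' ;; cg_step A st
  else ret R (CGState 0 b b).

End Arithmetic.

Definition vec2 (R : Type) (a b : R) : 'cV[R]_2 :=
  \col_i if i == ord0 then a else b.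

Definition mx2 (R : Type) (a b c d : R) : 'M[R]_2 :=
  \matrix_(i, j) if i == ord0 then (if j == ord0 then a else b)
                 else (if j == ord0 then c else d).

Definition vdot (R : realType) (n : nat) (x y : 'cV[R]_n) : R :=
  (x^T *m y) 0 0.

Definition positive_definite (R : realType) (n : nat) (M : 'M[R]_n) : Prop :=
  M^T = M /\ forall x : 'cV[R]_n, x != 0 -> 0 < vdot x (M *m x).

(* Main.v *)
(** Every rounding that enters alpha_2 is a rounding to a power of two: its exact
    argument is either zero or lies within a quarter of an upper spacing of some
    +-2^k.  Underflow is excluded by bootstrapping: the three exact results epsA,
    epsA h and h (epsA h) occur in the traces, and each one, once the preceding
    roundings are known, pushes emin down far enough to make the next ones exact;
    the last of them bounds emin below every other quantity. *)
Require Import Defs.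
From mathcomp Require Import all_boot all_order all_algebra.
From mathcomp Require Import all_classical all_reals all_analysis.
From mathcomp Require Import ring lra zify.
Import Order.TTheory GRing.Theory Num.Theory.
Local Open Scope ring_scope.

(** * Rounding to nearest around powers of two *)

Section Rounding.
Variable R : realType.
Implicit Types (x y : R) (e k emin : int).

(** The strict inequality excludes ties, so the parity test is never reached. For [x] below [n] the
    floor is [n - 1] and the fractional part exceeds one half. *)
Lemma rne_int_near x (n : int) : `|x - n%:~R| < 2^-1 -> rne_int x = n.
Proof.
rewrite ltr_norml => /andP[xl xu]; rewrite /rne_int.
have [nx|xn] := lerP n%:~R x.
  have -> : Num.floor x = n.
    by apply/floor_def; rewrite nx intrD mulr1z /=; lra.
  by rewrite xu.
have -> : Num.floor x = n - 1.
  by apply/floor_def; rewrite subrK xn intrB mulr1z andbT; lra.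
have dl : 2^-1 < x - (n - 1)%:~R by rewrite intrB mulr1z; lra.
by rewrite dl ltNge (ltW dl) /= subrK.
Qed.

Lemma ln_exprz2 k : ln ((2 : R) ^ k) = k%:~R * ln 2.
Proof.
case: k => n; first by rewrite -exprnP lnXn // mulr_natl.
rewrite NegzE -exprnN -exprVn lnXn ?invr_gt0 // lnV ?posrE //.
by rewrite mulNrn mulrNz mulNr -pmulrn mulr_natl.
Qed.

Lemma exprz2D e k : (2 : R) ^ (e + k) = 2 ^ e * 2 ^ k.
Proof. by rewrite expfzDr. Qed.

Lemma exprz2_gt0 k : 0 < (2 : R) ^ k.
Proof. by rewrite exprz_gt0. Qed.

Lemma ler_exprz2 e k : ((2 : R) ^ e <= 2 ^ k) = (e <= k).
Proof. by rewrite ler_eXz2l ?ltr1n. Qed.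

(** Only the two binades meeting at [2 ^ k] are possible, and [emin <= k] keeps the clamp at [emin]
    from raising the exponent above [k]. *)
Lemma round_exp_near emin k y :
  emin <= k -> 2 ^ (k - 1) <= `|y| < 2 ^ (k + 1) ->
  k - 1 <= round_exp emin y <= k.
Proof.
move=> ek /andP[yl yu]; rewrite /round_exp.
have y0 : 0 < `|y| by apply: lt_le_trans yl; exact: exprz2_gt0.
have l2 : 0 < ln (2 : R) by rewrite ln_gt0 ?ltr1n.
have lb : k - 1 <= Num.floor (ln `|y| / ln 2).
  rewrite floor_ge_int ler_pdivlMr // -ln_exprz2 ler_ln ?posrE //.
  exact: exprz2_gt0.
have ub : Num.floor (ln `|y| / ln 2) < k + 1.
  rewrite floor_lt_int ltr_pdivrMr // -ln_exprz2 ltr_ln ?posrE //.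
  exact: exprz2_gt0.
by apply/andP; split; lia.
Qed.

(* A quarter of the spacing above 2 ^ k is still within half the spacing
   below it, so both binades are covered. *)
Lemma fl_near (p : nat) emin (b : bool) k y :
  (0 < p)%N -> emin <= k ->
  `|y - (-1) ^+ b * 2 ^ k| < 2 ^ (k - p%:Z - 1) ->
  fl p emin y = (-1) ^+ b * 2 ^ k.
Proof.
move=> p0 ek yk.
have k0 := exprz2_gt0 k.
have small : (2 : R) ^ (k - p%:Z - 1) <= 2 ^ (k - 1) / 2.
  by rewrite -[2^-1](exprN1 2) -exprz2D ler_exprz2; lia.
have half : (2 : R) ^ (k - 1) = 2 ^ k / 2 by rewrite exprz2D exprN1.
have twice : (2 : R) ^ (k + 1) = 2 ^ k * 2 by rewrite exprz2D expr1z.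
have nk : `|(-1) ^+ b * 2 ^ k| = (2 : R) ^ k.
  by rewrite normrM normrX normrN1 expr1n mul1r gtr0_norm.
have /andP[el eu] : k - 1 <= round_exp emin y <= k.
  apply: round_exp_near => //.
  have := ler_dist_dist y ((-1) ^+ b * 2 ^ k); rewrite nk ler_norml => /andP[].
  by move=> *; apply/andP; split; lra.
rewrite /fl; set e := round_exp emin y in el eu *.
have ulp0 := exprz2_gt0 (e - p%:Z + 1).
(* Since [e <= k] and [0 < p], the exponent of the ulp is at most [k], so [2 ^ k] is an integer
   multiple of the ulp. *)
have [m km] : exists m : nat, k = m%:Z + (e - p%:Z + 1).
  by exists `|(k - (e - p%:Z + 1))%R|%N; lia.
have ->: (2 : R) ^ k = 2 ^+ m * 2 ^ (e - p%:Z + 1) by rewrite km exprz2D.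
rewrite (@rne_int_near _ ((-1) ^+ b * 2 ^+ m)); last first.
  rewrite -[X in _ - X](mulfK (lt0r_neq0 ulp0)) -mulrBl normrM normfV.
  rewrite (gtr0_norm ulp0) ltr_pdivrMr //.
  rewrite rmorphM !rmorphXn rmorphN1 -mulrA /=.
  have <- : (2 : R) ^ k = 2 ^+ m * 2 ^ (e - p%:Z + 1) by rewrite km exprz2D.
  (* The radius is exactly half an ulp when [e = k - 1] and a quarter of one when [e = k]. *)
  apply: lt_le_trans yk _.
  by rewrite -[2^-1](exprN1 2) -exprz2D ler_exprz2; lia.
by rewrite rmorphM !rmorphXn rmorphN1 -mulrA.
Qed.

Lemma fl_exprz2 (p : nat) emin k :
  (0 < p)%N -> emin <= k -> fl p emin (2 ^ k) = 2 ^ k :> R.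
Proof.
move=> p0 ek; rewrite (@fl_near _ _ false k) ?expr0 ?mul1r //.
by rewrite subrr normr0 exprz2_gt0.
Qed.

Lemma fl_opp_exprz2 (p : nat) emin k :
  (0 < p)%N -> emin <= k -> fl p emin (- 2 ^ k) = - 2 ^ k :> R.
Proof.
move=> p0 ek; rewrite (@fl_near _ _ true k) ?expr1 ?mulN1r //.
by rewrite subrr normr0 exprz2_gt0.
Qed.

Lemma fl0 (p : nat) emin : fl p emin 0 = 0 :> R.
Proof.
by rewrite /fl mul0r (@rne_int_near _ 0) ?mul0r // subrr normr0 invr_gt0.
Qed.

End Rounding.

(** * Navigation in sequenced computations *)

Section Traces.
Variables (R T U : Type).

Lemma value_bind (m : traced R T) (k : T -> traced R U) :
  value (bind m k) = value (k (value m)).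
Proof. by []. Qed.

End Traces.

(** This lemma and the next locate an operation in a trace: left enters the computation run first,
    right passes to the continuation at its stored value, which must then be known. *)
Lemma mem_exact_bindl (R : eqType) T U (m : traced R T) (k : T -> traced R U) y :
  y \in exact_results m -> y \in exact_results (bind m k).
Proof. by rewrite /exact_results mem_cat => ->. Qed.

Lemma mem_exact_bindr (R : eqType) T U (m : traced R T) (k : T -> traced R U) y :
  y \in exact_results (k (value m)) -> y \in exact_results (bind m k).
Proof. by rewrite /exact_results mem_cat orbC => ->. Qed.

(** * Coordinate formulas in dimension two *)

Section Dimension2.
Variables (R : realType) (p : nat) (emin : int).
Local Notation rd := (fl p emin).
Implicit Types (a b c d x y z t : R).

Lemma enum_ord2 : enum 'I_2 = [:: ord0; ord_max].
Proof. by apply: (inj_map val_inj); rewrite val_enum_ord. Qed.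

Lemma vec2_0 : 0 = vec2 0 0 :> 'cV[R]_2.
Proof. by apply/matrixP => i j; rewrite !mxE; case: ifP. Qed.

Lemma ord2E (i : 'I_2) : i = if i == ord0 then ord0 else ord_max.
Proof. by apply/val_inj; case: i => -[|[]]. Qed.

Lemma vec2E (x : 'cV[R]_2) : x = vec2 (x ord0 0) (x ord_max 0).
Proof.
by apply/matrixP => i j; rewrite !mxE (ord1 j) {1}(ord2E i); case: ifP.
Qed.

Lemma mx2E (M : 'M[R]_2) :
  M = mx2 (M ord0 ord0) (M ord0 ord_max) (M ord_max ord0) (M ord_max ord_max).
Proof.
apply/matrixP => i j; rewrite mxE {1}(ord2E i) {1}(ord2E j).
by do 2!case: ifP.
Qed.

Lemma value_fsqrt x : value (fsqrt p emin x) = rd (Num.sqrt x).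
Proof. by []. Qed.

Lemma fmulmx2 a b c d x y :
  value (fmulmx p emin (mx2 a b c d) (vec2 x y)) =
  vec2 (rd (rd (a * x) + rd (b * y))) (rd (rd (c * x) + rd (d * y))).
Proof. by rewrite [LHS]vec2E /value /= !mxE enum_ord2 /= !mxE. Qed.

(** Singles out the product involving the small diagonal entry of [A]; its normality is what bounds
    [emin]. *)
Lemma fmulmx2_exact a b c d x y :
  a * x \in exact_results (fmulmx p emin (mx2 a b c d) (vec2 x y)).
Proof. by rewrite /exact_results /= enum_ord2 /= !mxE mem_head. Qed.

Lemma fdot2 x y z t :
  value (fdot p emin (vec2 x y) (vec2 z t)) = rd (rd (x * z) + rd (y * t)).
Proof. by rewrite /fdot enum_ord2 /= !mxE. Qed.

Lemma fdot2_exact x y z t :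
  x * z \in exact_results (fdot p emin (vec2 x y) (vec2 z t)).
Proof. by rewrite /fdot enum_ord2 /= !mxE mem_head. Qed.

Lemma fvsub2 x y z t :
  value (fvsub p emin (vec2 x y) (vec2 z t)) = vec2 (rd (x - z)) (rd (y - t)).
Proof. by rewrite [LHS]vec2E /value /= !mxE. Qed.

Lemma fvdiv2 x y c :
  value (fvdiv p emin (vec2 x y) c) = vec2 (rd (x / c)) (rd (y / c)).
Proof. by rewrite [LHS]vec2E /value /= !mxE. Qed.

Lemma fvsub_scaled2 x y c z t :
  value (fvsub_scaled p emin (vec2 x y) c (vec2 z t)) =
  vec2 (rd (x - rd (c * z))) (rd (y - rd (c * t))).
Proof. by rewrite [LHS]vec2E /value /= !mxE. Qed.

Lemma vdot2 x y z t : vdot (vec2 x y) (vec2 z t) = x * z + y * t.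
Proof. by rewrite /vdot mxE !big_ord_recr big_ord0 /= add0r !mxE. Qed.

Lemma mulmx_vec2 a b c d x y :
  mx2 a b c d *m vec2 x y = vec2 (a * x + b * y) (c * x + d * y).
Proof.
apply/matrixP => i j; rewrite !mxE !big_ord_recr big_ord0 /= add0r !mxE /=.
by case: (i == ord0).
Qed.

Lemma mulmx2 a b c d x y z t :
  mx2 a b c d *m mx2 x y z t =
  mx2 (a * x + b * z) (a * y + b * t) (c * x + d * z) (c * y + d * t).
Proof.
apply/matrixP => i j; rewrite !mxE !big_ord_recr big_ord0 /= add0r !mxE /=.
by case: (i == ord0); case: (j == ord0).
Qed.

Lemma trmx2 a b c d : (mx2 a b c d)^T = mx2 a c b d.
Proof. by apply/matrixP => i j; rewrite !mxE; do 2!case: ifP. Qed.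

Lemma det_mx2 a b c d : \det (mx2 a b c d) = a * d - b * c.
Proof.
rewrite (expand_det_row _ ord0) !big_ord_recl big_ord0 addr0 /cofactor.
by rewrite !det_mx11 !mxE /= expr0 expr1 mul1r mulN1r mulrN.
Qed.

Lemma diag_mx_vec2 a b : diag_mx (vec2 a b)^T = mx2 a 0 0 b.
Proof. by rewrite [LHS]mx2E !mxE. Qed.

Lemma row_mx_vec2 x y z t :
  row_mx (vec2 x y) (vec2 z t) = mx2 x z y t :> 'M[R]_2.
Proof.
apply/matrixP => i j; rewrite !mxE /=.
by case: splitP => k jk; rewrite !mxE -[j == ord0]val_eqE /= jk (ord1 k).
Qed.

End Dimension2.

(** * Values stored by the Lanczos recurrence *)

Lemma value_lanczos_step (R : realType) p emin n (A : 'M[R]_n) u v a b :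
  value (lanczos_step p emin A (LanczosState u v a b)) =
  let q := value (fmulmx p emin A v) in
  let w := value (fvsub_scaled p emin q b u) in
  let alpha := value (fdot p emin v w) in
  let z := value (fvsub_scaled p emin w alpha v) in
  let beta := value (fsqrt p emin (value (fdot p emin z z))) in
  LanczosState v (value (fvdiv p emin z beta)) alpha beta.
Proof. by []. Qed.

Lemma value_lanczosS (R : realType) p emin n (A : 'M[R]_n) b x0 j :
  value (lanczos p emin A b x0 j.+1) =
  value (lanczos_step p emin A (value (lanczos p emin A b x0 j))).
Proof. by []. Qed.

Section LanczosRun.
Variables (R : realType) (p s : nat) (emin : int).
Hypotheses (p2 : (2 <= p)%N) (s_lb : (p + 2 <= s + s)%N).
Local Notation rd := (@fl R p emin).
(** Powers of two carry integer exponents, so that every absorption test becomes linear integer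
    arithmetic; [eps] is [h ^ 2 * u / 4] in this form. *)
Local Notation H := ((2 : R) ^ s%:Z).
Local Notation h := ((2 : R) ^ (- s%:Z)).
Local Notation eps := ((2 : R) ^ (- (s + s + p + 2)%N%:Z)).
Local Notation A := (mx2 eps 0 0 1).

Let p0 : (0 < p)%N. Proof. exact: ltnW. Qed.

Let fl1 : emin <= 0 -> rd 1 = 1.
Proof. by move=> e0; rewrite -(expr0z (2 : R)) fl_exprz2. Qed.

Lemma lanczos_init_value :
  emin <= - s%:Z ->
  value (lanczos_init p emin A (vec2 1 H) (vec2 0 0)) =
  LanczosState 0 (vec2 h 1) 0 H.
Proof.
move=> es.
have e0 : emin <= 0 by lia.
(* By [s_lb], a quarter of the spacing above [H ^ 2] is at least 2, so the 1 is absorbed; the square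
   root is then exactly [H]. *)
have rho : rd (1 + 2 ^ (s%:Z + s%:Z)) = 2 ^ (s%:Z + s%:Z).
  rewrite (@fl_near _ _ _ false (s%:Z + s%:Z)) ?expr0 ?mul1r //; first by lia.
  rewrite addrK normr1 -(expr0z (2 : R)) ltr_eXz2l ?ltr1n //; lia.
rewrite /lanczos_init !value_bind fmulmx2 !mulr0 !fl0 addr0 fl0.
rewrite fvsub2 !subr0 fl1 // fl_exprz2 //; last by lia.
rewrite fdot2 mulr1 fl1 // -exprz2D fl_exprz2 //; last by lia.
rewrite value_fsqrt rho exprz2D -expr2 sqrtr_sqr gtr0_norm ?exprz2_gt0 //.
rewrite fl_exprz2 //; last by lia.
by rewrite fvdiv2 divff ?gt_eqF ?exprz2_gt0 // div1r invr_expz fl1 // fl_exprz2.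
Qed.

(** Kept apart from the full step because a weaker bound on [emin] suffices: it identifies the first
    product of the inner product for [alpha], whose normality yields the stronger bound. *)
Lemma lanczos_step1_w :
  emin <= - (3 * s + p + 2)%N%:Z ->
  value (fvsub_scaled p emin (value (fmulmx p emin A (vec2 h 1))) H (vec2 0 0)) =
  vec2 (eps * h) 1.
Proof.
move=> es.
have e0 : emin <= 0 by lia.
rewrite fmulmx2 !mul0r mulr1 !fl0 addr0 add0r -exprz2D fl_exprz2 //; last by lia.
rewrite !fl1 // fl_exprz2 //; last by lia.
rewrite fvsub_scaled2 !mulr0 !fl0 !subr0 fl1 // fl_exprz2 //; lia.
Qed.

Lemma lanczos_step1_exact :
  emin <= - (3 * s + p + 2)%N%:Z ->
  h * (eps * h) \in
    exact_results (lanczos_step p emin A (LanczosState 0 (vec2 h 1) 0 H)).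
Proof.
(* The computations of [q] and [w] are skipped; the next one is the inner product for [alpha]. *)
move=> es; do 2!apply: mem_exact_bindr; apply: mem_exact_bindl.
rewrite [lst_v _]/= [lst_beta _]/= [lst_vprev _]/= vec2_0.
by rewrite lanczos_step1_w //; exact: fdot2_exact.
Qed.

(** Two absorptions decide this step: [eps * h ^ 2] against 1 in [alpha], then [eps * h] against [h]
    in the first component of [z]. The second component cancels to an exact 0. *)
Lemma lanczos_step1_value :
  emin <= - (4 * s + p + 2)%N%:Z ->
  value (lanczos_step p emin A (LanczosState 0 (vec2 h 1) 0 H)) =
  LanczosState (vec2 h 1) (vec2 (- 1) 0) 1 h.
Proof.
move=> es.
have e0 : emin <= 0 by lia.
(* The exponent of [eps * h], the first component of [w]. *)
set k : int := - (s + s + p + 2)%N%:Z + - s%:Z.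
have alpha : rd (2 ^ (- s%:Z + k) + 1) = 1.
  rewrite (@fl_near _ _ _ false 0) ?expr0 ?mul1r //.
  rewrite addrK gtr0_norm ?exprz2_gt0 // ltr_eXz2l ?ltr1n //; lia.
have z : rd (2 ^ k - h) = - h.
  rewrite (@fl_near _ _ _ true (- s%:Z)) ?expr1 ?mulN1r //; first by lia.
  rewrite opprK subrK gtr0_norm ?exprz2_gt0 // ltr_eXz2l ?ltr1n //; lia.
have h0 := exprz2_gt0 R (- s%:Z).
rewrite value_lanczos_step vec2_0; cbv zeta; rewrite lanczos_step1_w; last by lia.
rewrite -exprz2D -/k fdot2 -exprz2D mulr1 fl1 // fl_exprz2 //; last by lia.
rewrite alpha fvsub_scaled2 !mul1r fl1 // fl_exprz2 //; last by lia.
rewrite z subrr fl0 fdot2 mulrNN mulr0 fl0 addr0 -exprz2D.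
rewrite fl_exprz2 //; last by lia.
rewrite fl_exprz2 //; last by lia.
rewrite value_fsqrt exprz2D -expr2 sqrtr_sqr gtr0_norm //.
rewrite fl_exprz2 //; last by lia.
rewrite fvdiv2 mul0r mulNr divff ?gt_eqF // fl0.
by rewrite -(expr0z (2 : R)) fl_opp_exprz2.
Qed.

(** The loss of [eps] occurs before the inner product, in the first component [- eps - h ^ 2] of
    [w]: [eps] is an eighth of the spacing above [h ^ 2]. The zero in the current vector removes the
    other component. *)
Lemma lanczos_step2_alpha :
  emin <= - (4 * s + p + 2)%N%:Z ->
  lst_alpha (value (lanczos_step p emin A
    (LanczosState (vec2 h 1) (vec2 (- 1) 0) 1 h))) = h ^+ 2.
Proof.
move=> es.
have w : rd (- eps - h * h) = - 2 ^ (- s%:Z + - s%:Z).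
  rewrite (@fl_near _ _ _ true (- s%:Z + - s%:Z)) ?expr1 ?mulN1r //; first by lia.
  rewrite -exprz2D opprK subrK normrN gtr0_norm ?exprz2_gt0 //.
  rewrite ltr_eXz2l ?ltr1n //; lia.
rewrite value_lanczos_step /lst_alpha; cbv zeta iota.
rewrite fmulmx2 mulrN1 !mul0r mulr0 !fl0 !addr0 !fl0.
rewrite fl_opp_exprz2 //; last by lia.
rewrite fl_opp_exprz2 //; last by lia.
rewrite fvsub_scaled2 mulr1 sub0r -exprz2D fl_exprz2 //; last by lia.
rewrite fl_exprz2 //; last by lia.
rewrite exprz2D w fl_opp_exprz2 //; last by lia.
rewrite fdot2 mulN1r opprK mul0r fl0 addr0 fl_exprz2 //; last by lia.
by rewrite fl_exprz2 ?exprz2D -?expr2 //; lia.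
Qed.

(** The same absorption for a single rounding of the exact expression, independent of the operation
    order of the recurrence. *)
Lemma fl_eps_h2 : emin <= - (s + s)%N%:Z -> rd (eps + h ^+ 2) = h ^+ 2.
Proof.
move=> es; rewrite expr2 -exprz2D.
rewrite (@fl_near _ _ _ false (- s%:Z + - s%:Z)) ?expr0 ?mul1r //; first by lia.
by rewrite addrK gtr0_norm ?exprz2_gt0 // ltr_eXz2l ?ltr1n //; lia.
Qed.

End LanczosRun.

(** * Bounds on [emin] from normality, then exact algebra on the stored basis *)

Theorem proposition2 (R : realType) (p : nat) (emin emax : int)
    (hp : (2 <= p)%N) (hexp : emin <= emax) :
  let u : R := 2 ^- p in
  let s : nat := uphalf (p + 2) in
  let H : R := 2 ^+ s in
  let h : R := H^-1 in
  let epsA : R := h ^+ 2 * u / 4 in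
  let A : 'M[R]_2 := diag_mx (vec2 epsA 1)^T in
  let b : 'cV[R]_2 := vec2 1 H in
  let x0 : 'cV[R]_2 := 0 in
  let rd : R -> R := fl p emin in
  let v1 : 'cV[R]_2 := lanczos_v p emin A b x0 1 in
  let v2 : 'cV[R]_2 := lanczos_v p emin A b x0 2 in
  let beta2 : R := lanczos_beta p emin A b x0 2 in
  let alpha2 : R := lanczos_alpha p emin A b x0 2 in
  let T2 : 'M[R]_2 := lanczos_T2 p emin A b x0 in
  let V2 : 'M[R]_2 := row_mx v1 v2 in
  let G : 'M[R]_2 := V2^T *m A *m V2 in
  let local_term : R := - (beta2 * vdot v2 v1) in
  (forall y : R,
     y \in exact_results (cg p emin A b 4)
           ++ exact_results (lanczos p emin A b x0 2) ->
     y != 0 -> normal_result emin y /\ finite_result p emin emax y) ->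
  (v1 = vec2 h 1 /\ v2 = vec2 (-1) 0)
  /\ vdot v1 v2 = - h
  /\ (beta2 * vdot v1 v2 = - h ^+ 2
      /\ (- h ^+ 2 = - (u / 4) \/ - h ^+ 2 = - (u / 8)))
  /\ (alpha2 = rd (vdot v2 (A *m v2) - beta2 * vdot v2 v1)
      /\ vdot v2 (A *m v2) - beta2 * vdot v2 v1 = epsA + h ^+ 2
      /\ rd (epsA + h ^+ 2) = h ^+ 2)
  /\ G = mx2 (1 + epsA * h ^+ 2) (- (epsA * h)) (- (epsA * h)) epsA
  /\ (positive_definite G /\ \det G = epsA)
  /\ (local_term = h ^+ 2
      /\ vdot v2 (A *m v2) = epsA
      /\ epsA = local_term * u / 4 /\ epsA < local_term
      /\ T2 ord_max ord_max = rd (epsA + local_term)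
      /\ rd (epsA + local_term) = local_term)
  /\ (T2 = mx2 1 h h (h ^+ 2) /\ \det T2 = 0).
Proof.
move=> u s H h epsA A b x0 rd v1 v2 beta2 alpha2 T2 V2 G local_term hnormal.
have p0 : (0 < p)%N by exact: ltnW.
have s_lb : (p + 2 <= s + s)%N by rewrite /s; lia.
have s_ub : (s + s <= p + 3)%N by rewrite /s; lia.
have hE : h = 2 ^ (- s%:Z) by rewrite /h /H -exprnN.
have h0 : 0 < h by rewrite hE exprz2_gt0.
have h2E : h ^+ 2 = (2 ^+ (s + s))^-1 by rewrite /h /H expr2 -invfM -exprD.
have four : 4 = 2 ^+ 2 :> R by rewrite -natrX.
have u0 : 0 < u by rewrite invr_gt0 exprn_gt0.
have u1 : u < 1 by rewrite invf_lt1 ?exprn_gt0 // exprn_egt1 // ?ltr1n //; lia.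
have epsE : epsA = 2 ^ (- (s + s + p + 2)%N%:Z).
  by rewrite /epsA h2E four -exprnN !exprD !invfM.
have AE : A = mx2 epsA 0 0 1 by rewrite /A diag_mx_vec2.
have normal k : 2 ^ k \in exact_results (cg p emin A b 4)
    ++ exact_results (lanczos p emin A b x0 2) -> emin <= k.
  move=> /hnormal /(_ (lt0r_neq0 (exprz2_gt0 R k)))[].
  by rewrite /normal_result gtr0_norm ?exprz2_gt0 // ler_exprz2.
have x00 : x0 = vec2 0 0 := vec2_0 R.
(* The first CG product is [epsA * 1], since [p_0 = b] has first component 1; this bounds [emin]
   before any Lanczos vector is known. *)
have e1 : emin <= - (s + s + p + 2)%N%:Z.
  apply: normal; rewrite mem_cat -epsE; apply/orP; left.
  do 3!apply: mem_exact_bindl; apply: mem_exact_bindr; apply: mem_exact_bindl.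
  by rewrite AE -[X in X \in _]mulr1; exact: fmulmx2_exact.
have init : value (lanczos p emin A b x0 0) = LanczosState 0 (vec2 h 1) 0 H.
  rewrite [LHS]/(value (lanczos_init _ _ _ _ _)) x00 AE epsE hE.
  by apply: lanczos_init_value => //; lia.
(* With [v1] now known, [epsA * h] is found in the product of [A] with [v1]. *)
have e2 : emin <= - (3 * s + p + 2)%N%:Z.
  have -> : - (3 * s + p + 2)%N%:Z = - (s + s + p + 2)%N%:Z + - s%:Z by lia.
  apply: normal; rewrite mem_cat; apply/orP; right.
  apply: mem_exact_bindl; apply: mem_exact_bindr; rewrite init.
  by apply: mem_exact_bindl; rewrite AE epsE exprz2D -hE; exact: fmulmx2_exact.
(* The product [h * (epsA * h)] opens the inner product for the first diagonal coefficient; its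
   exponent lies below those of all later nonzero results needed here. *)
have e3 : emin <= - (4 * s + p + 2)%N%:Z.
  have -> : - (4 * s + p + 2)%N%:Z =
      - s%:Z + (- (s + s + p + 2)%N%:Z + - s%:Z) by lia.
  apply: normal; rewrite mem_cat; apply/orP; right.
  apply: mem_exact_bindl; apply: mem_exact_bindr; rewrite init.
  by rewrite AE epsE !exprz2D hE; exact: lanczos_step1_exact.
have step1 : value (lanczos p emin A b x0 1) =
    LanczosState (vec2 h 1) (vec2 (- 1) 0) 1 h.
  by rewrite value_lanczosS init AE epsE hE lanczos_step1_value.
have v1E : v1 = vec2 h 1 by rewrite /v1 /lanczos_v init.
have v2E : v2 = vec2 (- 1) 0 by rewrite /v2 /lanczos_v step1.
have beta2E : beta2 = h by rewrite /beta2 /lanczos_beta step1.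
have alpha1E : lanczos_alpha p emin A b x0 1 = 1 by rewrite /lanczos_alpha step1.
have alpha2E : alpha2 = h ^+ 2.
  by rewrite /alpha2 /lanczos_alpha value_lanczosS step1 AE epsE hE lanczos_step2_alpha.
have rdE : rd (epsA + h ^+ 2) = h ^+ 2.
  by rewrite /rd epsE hE fl_eps_h2 //; lia.
have T2E : T2 = mx2 1 h h (h ^+ 2).
  by rewrite [T2]mx2E !mxE /= -/alpha2 -/beta2 alpha1E alpha2E beta2E.
have GE : G = mx2 (1 + epsA * h ^+ 2) (- (epsA * h)) (- (epsA * h)) epsA.
  rewrite /G /V2 v1E v2E row_mx_vec2 trmx2 AE !mulmx2.
  by congr mx2; ring.
have localE : local_term = h ^+ 2.
  by rewrite /local_term beta2E v1E v2E vdot2; ring.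
have v2Av2 : vdot v2 (A *m v2) = epsA.
  by rewrite v2E AE mulmx_vec2 vdot2; ring.
have eps0 : 0 < epsA by rewrite epsE exprz2_gt0.
split; first by [].
split; first by rewrite v1E v2E vdot2; ring.
split.
  split; first by rewrite beta2E v1E v2E vdot2; ring.
  (* The ceiling leaves two cases according to the parity of [p]: even gives [u / 4], odd gives
     [u / 8]. *)
  have [sE|sE] : (s + s = p + 2 \/ s + s = p + 3)%N by lia.
    by left; rewrite h2E sE exprD invfM four.
  by right; rewrite h2E sE exprD invfM (_ : 8 = 2 ^+ 3) // -natrX.
have sumE : vdot v2 (A *m v2) - beta2 * vdot v2 v1 = epsA + h ^+ 2.
  by rewrite v2Av2 -localE.
split; first by rewrite sumE rdE alpha2E.
split; first by [].
split.
  (* The value agrees with the determinant of [A], as [V2] has determinant 1. *)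
  split; last by rewrite GE det_mx2; ring.
  split; first by rewrite GE trmx2.
  move=> x; rewrite [x]vec2E GE; set y := x ord0 0; set z := x ord_max 0 => yz.
  rewrite mulmx_vec2 vdot2.
  (* The quadratic form of [A] at [V2] applied to [(y, z)], which is [(h * y - z, y)]: a sum of
     squares with weights [epsA] and 1. If [y] vanishes, then [z] does not and the [epsA] term is
     positive. *)
  have -> : y * ((1 + epsA * h ^+ 2) * y + - (epsA * h) * z) +
     z * (- (epsA * h) * y + epsA * z) = y ^+ 2 + epsA * (h * y - z) ^+ 2 by ring.
  have [y0|y0] := eqVneq y 0; last first.
    by rewrite ltr_wpDr ?exprn_even_gt0 // mulr_ge0 ?sqr_ge0 ?ltW.
  have z0 : z != 0 by apply: contraNneq yz => ->; rewrite y0 -vec2_0.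
  by rewrite y0 expr0n mulr0 sub0r sqrrN add0r mulr_gt0 // exprn_even_gt0.
split; last by rewrite T2E det_mx2; split => //; ring.
split; first by [].
split; first by [].
split; first by rewrite localE.
split; first by rewrite localE /epsA -mulrA gtr_pMr ?exprn_gt0 //; lra.
by rewrite T2E mxE /= localE rdE.
Qed.
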